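(* Let $(V,\Omega)$ be a symplectic vector space and let $\theta$ be the canonical Liouville form on $V$, given by $\theta_z(v_z)=\frac12\Omega(z,v)$ for $z,v\in V$. Let $g:V\to V$ be a smooth map (not assumed to be a diffeomorphism). If $g^*\theta=\theta$ then $g\in{\rm Sp}(V,\Omega)$; in particular $g$ is linear.
   Context: A symplectic vector space $(V,\Omega)$ is a finite-dimensional real vector space $V$ with a nonsingular alternating bilinear form $\Omega$. Regard $V$ as a smooth manifold; for $z,v\in V$ let $v_z\in T_zV$ be the tangent vector given by $v_z\psi=\frac{\rm d}{{\rm d}t}\psi(z+tv)|_{t=0}$ for smooth $\psi:V\to\mathbb{R}$. ${\rm Sp}(V,\Omega)$ is the group of linear automorphisms $g$ of $V$ with $\Omega(gx,gy)=\Omega(x,y)$ for all $x,y\in V$. *)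

(* Defs.v *)
From HB Require Import structures.
From mathcomp Require Import all_boot all_order all_algebra.
From mathcomp Require Import all_classical all_reals topology normedtype derive.

Set Implicit Arguments.
Unset Strict Implicit.
Unset Printing Implicit Defensive.

Import Order.TTheory GRing.Theory Num.Theory.
Import numFieldNormedType.Exports.
Import VectorInternalTheory.

Local Open Scope classical_set_scope.
Local Open Scope ring_scope.

(* In finite dimension the continuity of [x |-> 'D_v f x] for every fixed [v]
   is the continuity of the Frechet derivative [x |-> 'd f x]. *)
Fixpoint class_C (R : realType) (U W : normedModType R) (k : nat) (f : U -> W)
    : Prop :=
  if k is k'.+1 then
    (forall x, differentiable f x) /\ (forall v, class_C k' ('D_v f))
  else continuous f.

Definition class_Cinfty (R : realType) (U W : normedModType R) (f : U -> W) :=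
  forall k, class_C k f.

(* The smooth structure of a finite-dimensional vector space is given by the
   single global chart [v2r : V -> 'rV_(dim V)], the coordinates in a basis;
   another basis changes the chart by an invertible linear map only. *)
Definition in_chart (R : realType) (V W : vectType R) (f : V -> W)
    : 'rV[R]_(dim V) -> 'rV[R]_(dim W) :=
  v2r \o f \o r2v.

Definition smooth_map (R : realType) (V W : vectType R) (f : V -> W) : Prop :=
  class_Cinfty (in_chart f).

Definition smooth_fun (R : realType) (V : vectType R) (psi : V -> R) : Prop :=
  class_Cinfty (psi \o r2v : 'rV[R]_(dim V) -> R).

(* The tangent vector v_z, as a derivation on smooth functions. *)
Definition tangent_vector (R : realType) (V : vectType R) (z v : V)
    (psi : V -> R) : R :=
  derive1 (fun t : R => psi (z + t *: v)) 0.

(* T_z V is identified with V by v |-> v_z: [tangent_map f z v] is the vector w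
   such that df_z(v_z) = w_(f z), where df_z(v_z) psi = v_z(psi o f) as proved
   in [tangent_mapP]. *)
Definition tangent_map (R : realType) (V W : vectType R) (f : V -> W) (z v : V)
    : W :=
  r2v ('d (in_chart f) (v2r z) (v2r v)).

Lemma tangent_vectorE (R : realType) (V : vectType R) (z v : V)
    (psi : V -> R) :
  tangent_vector z v psi =
  'D_(v2r v) (psi \o r2v : 'rV[R]_(dim V) -> R) (v2r z).
Proof.
rewrite /tangent_vector /derive1 /derive.
set d := (d in d @ _); set d' := (d' in _ = lim (d' @ _)).
suff -> : d = d' by [].
apply/funext => h; rewrite /d /d' /= addr0 scale0r addr0.
have <- : r2v (h *: v2r v + v2r z) = z + h *: v.
  by rewrite linearD linearZ /= !v2rK addrC.
by rewrite v2rK.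
Qed.

Lemma tangent_mapP (R : realType) (V W : vectType R) (f : V -> W) (z v : V)
    (psi : W -> R) :
  smooth_map f -> smooth_fun psi ->
  tangent_vector (f z) (tangent_map f z v) psi = tangent_vector z v (psi \o f).
Proof.
move=> smooth_f smooth_psi.
have dF : differentiable (in_chart f) (v2r z) by case: (smooth_f 1%N).
have Fz : in_chart f (v2r z) = v2r (f z) by rewrite /in_chart /= v2rK.
have dP : differentiable (psi \o r2v : 'rV[R]_(dim W) -> R)
    (in_chart f (v2r z)).
  by case: (smooth_psi 1%N).
have chain : (psi \o f) \o r2v = (psi \o r2v) \o in_chart f.
  by apply/funext => a; rewrite /in_chart /= v2rK.
rewrite !tangent_vectorE chain r2vK -Fz deriveE // deriveE; last first.
  exact: differentiable_comp.
by rewrite diff_comp.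
Qed.

(* A differential 1-form alpha on V is given by (z, v) |-> alpha_z(v_z). *)
Definition one_form (R : realType) (V : vectType R) := V -> V -> R.

Definition pullback (R : realType) (V W : vectType R) (f : V -> W)
    (alpha : one_form W) : one_form V :=
  fun z v => alpha (f z) (tangent_map f z v).

Definition symplectic_form (R : realType) (V : vectType R)
    (Omega : {biscalar V}) : Prop :=
  (forall x, Omega x x = 0) /\
  (forall x, (forall y, Omega x y = 0) -> x = 0).

Definition liouville_form (R : realType) (V : vectType R) (Omega : {biscalar V})
    : one_form V :=
  fun z v => 2^-1 * Omega z v.

Definition Sp (R : realType) (V : vectType R) (Omega : {biscalar V})
    : set (V -> V) :=
  [set g | [/\ linear g, bijective g &
              forall x y, Omega (g x) (g y) = Omega x y]].

(* Main.v *)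
Require Import Defs.
From HB Require Import structures.
From mathcomp Require Import all_boot all_order all_algebra.
From mathcomp Require Import all_classical all_reals topology normedtype derive.
From mathcomp Require Import ring lra.

Set Implicit Arguments.
Unset Strict Implicit.
Unset Printing Implicit Defensive.

Import Order.TTheory GRing.Theory Num.Theory.
Import numFieldNormedType.Exports.
Import VectorInternalTheory.

Local Open Scope ring_scope.

(** Write [D_v g] for the directional derivative of [g], and let the hypothesis
    read [Omega (g z) (D_v g z) = Omega z v] for all [z] and [v].

    Differentiating it along [u] gives
    [Omega (D_u g) (D_v g) + Omega g (D_u (D_v g)) = Omega u v].  Second
    derivatives commute ([derive_commute]), so subtracting the same identity with
    [u] and [v] exchanged removes the second-order term and leaves
    [Omega (D_u g z) (D_v g z) = Omega u v] ([derive_isometry]): this is the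
    invariance of the symplectic form [d theta].  In particular each
    differential of [g] is invertible, [Omega] being nondegenerate.

    The Liouville form is the contraction of the symplectic form with the Euler
    vector field [z |-> z], up to a factor, so [g] has to preserve this field.
    Concretely, [Omega (g z) (D_v g z) = Omega z v = Omega (D_z g z) (D_v g z)]
    for all [v], and the vectors [D_v g z] fill the space, whence
    [g z = D_z g z] ([pullback_euler]).

    Thus [g] is homogeneous of degree one.  A homogeneous map of degree one is
    linear as soon as it is smooth at the origin: [t |-> D_z g (t z)] is constant
    ([euler_linear]), and comparing its values at [1] and [0] gives
    [g z = D_z g 0], which is linear in [z].  So [g] is its own differential at
    the origin, an invertible linear map that preserves [Omega]. *)

(** * Second directional derivatives commute *)

Lemma is_derive_line (R : realType) (U W : normedModType R) (f : U -> W)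
    (x v : U) (t : R) (df : W) :
  is_derive (x + t *: v) v f df ->
  is_derive t 1 (fun s : R => f (x + s *: v)) df.
Proof.
have lineE : (fun h : R => h^-1 *:
      (((fun s : R => f (x + s *: v)) \o shift t) (h *: 1) - f (x + t *: v))) =
    (fun h => h^-1 *: ((f \o shift (x + t *: v)) (h *: v) - f (x + t *: v))).
  apply/funext => h /=.
  by rewrite [h *: 1](mulr1) scalerDl addrCA.
by move=> [df_ex df_val]; split; rewrite /derivable /derive lineE.
Qed.

Lemma is_derive_translate (R : realType) (U W : normedModType R) (f : U -> W)
    (x u w : U) (df : W) :
  is_derive (x + w) u f df -> is_derive x u (fun y => f (y + w)) df.
Proof.
have translateE : (fun h : R => h^-1 *:
      (((fun y => f (y + w)) \o shift x) (h *: u) - f (x + w))) =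
    (fun h => h^-1 *: ((f \o shift (x + w)) (h *: u) - f (x + w))).
  by apply/funext => h /=; rewrite addrA.
by move=> [df_ex df_val]; split; rewrite /derivable /derive translateE.
Qed.

Lemma MVT_line (R : realType) (U : normedModType R) (f df : U -> R) (x v : U)
    (t : R) :
  (forall y, is_derive y v f (df y)) -> 0 < t ->
  exists2 c, 0 < c < t & f (x + t *: v) - f x = df (x + c *: v) * t.
Proof.
move=> is_df t0.
have fline s := is_derive_line (is_df (x + s *: v)).
have cont : {within `[0, t], continuous (fun s : R => f (x + s *: v))}%classic.
  by apply: derivable_within_continuous => s _; case: (fline s).
have [c] := MVT t0 (fun s _ => fline s) cont.
by rewrite in_itv /= scale0r addr0 subr0; exists c.
Qed.

(** The second difference of [f] over the parallelogram spanned by [t u] and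
    [t v] is symmetric in [u] and [v], while the mean value theorem, applied along
    [u] and then along [v], expresses it by a mixed derivative at a nearby point:
    this is what compares the two mixed derivatives. *)
Lemma second_difference (R : realType) (U : normedModType R)
    (f fu fuv : U -> R) (x u v : U) (t : R) :
  (forall y, is_derive y u f (fu y)) -> (forall y, is_derive y v fu (fuv y)) ->
  0 < t ->
  exists a b, [/\ 0 < a < t, 0 < b < t &
    f (x + t *: v + t *: u) - f (x + t *: v) - (f (x + t *: u) - f x)
      = fuv (x + a *: u + b *: v) * t * t].
Proof.
move=> is_fu is_fuv t0.
(* The increment of [f] along [v], to be varied along [u]. *)
have is_d y :
    is_derive y u (fun y => f (y + t *: v) - f y) (fu (y + t *: v) - fu y).
  have := is_derive_translate (is_fu (y + t *: v)).
  by move=> is_ft; have := is_fu y; exact: is_deriveB.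
have [a at_ da] := MVT_line x is_d t0.
have [b bt db] := MVT_line (x + a *: u) is_fuv t0.
exists a, b; split => //.
by rewrite -db -da [x + t *: v + _]addrAC; ring.
Qed.

(** Schwarz's theorem.  Both mixed derivatives take the value of the second
    difference divided by [t ^ 2], at points that tend to [x] with [t]; continuity
    at [x] then identifies their values at [x]. *)
Lemma derive_commute (R : realType) (U : normedModType R)
    (f fu fv fuv fvu : U -> R) (x u v : U) :
  (forall y, is_derive y u f (fu y)) -> (forall y, is_derive y v f (fv y)) ->
  (forall y, is_derive y v fu (fuv y)) -> (forall y, is_derive y u fv (fvu y)) ->
  {for x, continuous fuv} -> {for x, continuous fvu} ->
  fuv x = fvu x.
Proof.
move=> is_fu is_fv is_fuv is_fvu cuv cvu.
(* Continuity of [F] restricted to the corner at [x] spanned by [p] and [q],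
   the region where the intermediate points lie. *)
have near_x (p q : U) (F : U -> R) (e : R) : {for x, continuous F} -> 0 < e ->
    exists2 d : R, 0 < d & forall a b, 0 < a < d -> 0 < b < d ->
      `|F x - F (x + a *: p + b *: q)| < e.
  move=> Fx e0.
  have Fc : (F (x + z.1 *: p + z.2 *: q) @[z --> ((0 : R), (0 : R))]
      --> F x)%classic.
    have L : (x + z.1 *: p + z.2 *: q @[z --> ((0 : R), (0 : R))]
        --> x + (0 : R) *: p + (0 : R) *: q)%classic.
      apply: cvgD; first apply: cvgD; first exact: cvg_cst.
      - by apply: cvgZ; [exact: cvg_fst | exact: cvg_cst].
      - by apply: cvgZ; [exact: cvg_snd | exact: cvg_cst].
    rewrite !scale0r !addr0 in L.
    exact: cvg_comp L Fx.
  move/cvgrPdist_lt/(_ e e0)/nbhs_ballP: Fc => [d /= d0 dP].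
  exists d => // a b /andP[a0 ad] /andP[b0 bd].
  apply: (dP (a, b)); split; rewrite /ball /= sub0r normrN gtr0_norm //.
apply/eqP; rewrite -subr_eq0 -normr_le0; apply/ler_addgt0Pl => e e0.
rewrite addr0.
have e20 : 0 < e / 2 by rewrite divr_gt0.
have [d1 d10 P1] := near_x u v _ _ cuv e20.
have [d2 d20 P2] := near_x v u _ _ cvu e20.
pose t := Num.min d1 d2.
have t0 : 0 < t by rewrite /t lt_min d10.
have [a [b [/andP[a0 at_] /andP[b0 bt] D1]]] := second_difference x is_fu is_fuv t0.
have [c [d [/andP[c0 ct] /andP[d0 dt] D2]]] := second_difference x is_fv is_fvu t0.
have [td1 td2] : t <= d1 /\ t <= d2 by rewrite /t !ge_min !lexx orbT.
have {}D1 : fuv (x + a *: u + b *: v) = fvu (x + c *: v + d *: u).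
  have tn0 : t != 0 by rewrite gt_eqF.
  apply: (mulIf tn0); apply: (mulIf tn0); rewrite -D1 -D2.
  by rewrite [x + t *: u + _]addrAC; ring.
have {}P1 := P1 a b; have {}P2 := P2 c d.
rewrite D1 a0 b0 (lt_le_trans at_ td1) (lt_le_trans bt td1) in P1.
rewrite c0 d0 (lt_le_trans ct td2) (lt_le_trans dt td2) distrC in P2.
rewrite ltW // [e]splitr -(subrKA (fvu (x + c *: v + d *: u))).
by rewrite (le_lt_trans (ler_normD _ _)) // ltrD ?P1 ?P2.
Qed.

(** * Maps into coordinate spaces *)

Section Coordinates.
Variables (R : realType) (E : normedModType R).

Lemma is_derive_coord n (P : E -> 'rV[R]_n) (x u : E) (dP : 'rV[R]_n)
    (i : 'I_1) (j : 'I_n) :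
  is_derive x u P dP -> is_derive x u (fun y => P y i j) (dP i j).
Proof.
move=> [P_ex <-]; rewrite derive_mx // mxE.
by apply: derivableP; move/derivable_mxP: P_ex.
Qed.

(** The Leibniz rule.  Expanding [B] in coordinates makes the function a finite
    sum of products of scalar functions, so that no continuity of [B] has to be
    established first. *)
Lemma is_derive_biscalar (V : vectType R) (B : {biscalar V})
    (P Q : E -> 'rV[R]_(dim V)) (x u : E) (dP dQ : 'rV[R]_(dim V)) :
  is_derive x u P dP -> is_derive x u Q dQ ->
  is_derive x u (fun y => B (r2v (P y)) (r2v (Q y)))
    (B (r2v dP) (r2v (Q x)) + B (r2v (P x)) (r2v dQ)).
Proof.
move=> is_dP is_dQ; pose c (i j : 'I_(dim V)) : R :=
  B (r2v (delta_mx 0 i)) (r2v (delta_mx 0 j)).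
have BE (p q : 'rV[R]_(dim V)) :
    B (r2v p) (r2v q) = \sum_i \sum_j c i j * (p 0 i * q 0 j).
  rewrite {1}[p]row_sum_delta linear_sum linear_sumlz.
  apply: eq_bigr => i _.
  rewrite {1}[q]row_sum_delta !linear_sum; apply: eq_bigr => j _.
  by rewrite !linearZ /= linearZl_LR linearZr_LR /= /c /GRing.scale /=; ring.
have -> : (fun y : E => B (r2v (P y)) (r2v (Q y))) =
    \sum_i \sum_j (fun y => c i j * (P y 0 i * Q y 0 j) : R).
  apply/funext => y; rewrite BE fct_sumE; apply: eq_bigr => i _.
  by rewrite fct_sumE.
rewrite !BE -big_split /=; apply: is_derive_sum => i.
rewrite -big_split /=; apply: is_derive_sum => j.
have Pi := is_derive_coord 0 i is_dP; have Qj := is_derive_coord 0 j is_dQ.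
have M := is_deriveZ (c i j) (is_deriveM Pi Qj).
apply: is_derive_eq M _.
by rewrite /GRing.scale /=; ring.
Qed.

End Coordinates.

Lemma derive_commute_rV (R : realType) (U : normedModType R) n
    (G : U -> 'rV[R]_n) :
  class_C 2 G -> forall x u v, 'D_v ('D_u G) x = 'D_u ('D_v G) x.
Proof.
move=> [dG /all_and2[ddG cG]] x u v; apply/rowP => j.
have is_d y w : is_derive y w (fun y => G y 0 j) ('D_w G y 0 j).
  exact/is_derive_coord/derivableP/diff_derivable.
have is_dd y w w' :
    is_derive y w' (fun y => 'D_w G y 0 j) ('D_w' ('D_w G) y 0 j).
  exact/is_derive_coord/derivableP/diff_derivable.
have cont w w' : {for x, continuous (fun y => 'D_w' ('D_w G) y 0 j)}.
  apply: (@continuous_comp _ _ _ ('D_w' ('D_w G)) (fun r => r 0 j)).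
    exact: cG.
  exact: coord_continuous.
exact: (derive_commute (is_d^~ u) (is_d^~ v) (fun y => is_dd y u v)
  (fun y => is_dd y v u) (cont u v) (cont v u)).
Qed.

(** Euler's identity makes [G] homogeneous of degree one, and differentiability
    of [D_x G] extends homogeneity to the origin.  Put [k t = D_x G (t x)].  On the
    line, Euler's identity reads [G (t x) = t k t], and the derivative of its left
    side is [k t]; the product rule then gives [t k' t = 0]. *)
Lemma euler_linear (R : realType) (U : normedModType R) n
    (G : U -> 'rV[R]_n) :
  (forall x, differentiable G x) -> (forall v x, differentiable ('D_v G) x) ->
  (forall x, G x = 'D_x G x) -> forall x, G x = 'D_x G 0.
Proof.
move=> dG ddG euler x; apply/rowP => j.
pose k (t : R) := 'D_x G (t *: x) 0 j.
have is_k (t : R) : is_derive t 1 k ('D_x ('D_x G) (t *: x) 0 j).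
  have is_DG : is_derive (0 + t *: x) x ('D_x G) ('D_x ('D_x G) (t *: x)).
    by rewrite add0r; exact/derivableP/diff_derivable.
  have is_line := is_derive_line is_DG.
  have -> : k = fun s => 'D_x G (0 + s *: x) 0 j.
    by apply/funext => s; rewrite add0r.
  exact: is_derive_coord.
have is_G (t : R) : is_derive t 1 (fun s : R => s * k s) (k t).
  have is_DG : is_derive (0 + t *: x) x G ('D_x G (t *: x)).
    by rewrite add0r; exact/derivableP/diff_derivable.
  have is_line := is_derive_line is_DG.
  rewrite /k.
  have -> : (fun s : R => s * 'D_x G (s *: x) 0 j) = (fun s => G (0 + s *: x) 0 j).
    apply/funext => s; rewrite add0r (euler (s *: x)) !deriveE //.
    by rewrite linearZ mxE.
  exact: is_derive_coord.
have k'0 (t : R) : t \in `]0, 1[ -> is_derive t 1 k (cst 0 t).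
  rewrite in_itv /= => /andP[t0 _].
  have := is_deriveM (is_derive_id t 1) (is_k t).
  move=> -[_ E]; case: (is_G t) => _; rewrite [LHS]E => E'.
  apply: is_derive_eq (is_k t) _.
  move: E'; rewrite /GRing.scale /= mulr1 => /eqP.
  rewrite -subr_eq0 addrK mulf_eq0 gt_eqF //=.
  by move/eqP.
have cont : {within `[0, 1], continuous k}%classic.
  by apply: derivable_within_continuous => s _; case: (is_k s).
have [c _] := MVT ltr01 k'0 cont.
move=> /eqP; rewrite mul0r subr_eq0 /k scale1r scale0r => /eqP <-.
by rewrite -euler.
Qed.

(** * Maps preserving the Liouville form *)

Section Symplectic.
Variables (R : realType) (V : vectType R) (Omega : {biscalar V}).
Hypothesis symplectic_Omega : symplectic_form Omega.

Lemma symplectic_skew x y : Omega x y = - Omega y x.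
Proof.
have [alt _] := symplectic_Omega.
apply/eqP; rewrite -addr_eq0; apply/eqP.
have := alt (x + y).
by rewrite linearDl linearDr linearDr !alt /= add0r addr0.
Qed.

(** An isometry has trivial kernel, because a vector of the kernel is orthogonal
    to the whole space. *)
Lemma isometry_unitmx (A : 'M[R]_(dim V)) :
  (forall u v : 'rV_(dim V),
     Omega (r2v (u *m A)) (r2v (v *m A)) = Omega (r2v u) (r2v v)) ->
  A \in unitmx.
Proof.
move=> isoA; rewrite -row_free_unit -kermx_eq0; apply/rowV0P => u.
move=> /sub_kermxP uA.
have [_ nondeg] := symplectic_Omega.
rewrite -[u]r2vK [r2v u]nondeg ?linear0 // => y.
by rewrite -[y]v2rK -isoA uA linear0 linear0l.
Qed.

Variable G : 'rV[R]_(dim V) -> 'rV[R]_(dim V).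
Hypothesis smooth_G : class_C 2 G.
Hypothesis pullback_G : forall x v,
  Omega (r2v (G x)) (r2v ('D_v G x)) = Omega (r2v x) (r2v v).

(** The invariance of [d theta], with [d] computed by hand: the pullback identity
    is differentiated along [u] and antisymmetrized in [u] and [v]. *)
Lemma derive_isometry x u v :
  Omega (r2v ('D_u G x)) (r2v ('D_v G x)) = Omega (r2v u) (r2v v).
Proof.
have [dG /all_and2[ddG _]] := smooth_G.
(* The pullback identity in direction [b], differentiated along [a]. *)
have diff_pullback (a b : 'rV[R]_(dim V)) :
    Omega (r2v ('D_a G x)) (r2v ('D_b G x)) +
    Omega (r2v (G x)) (r2v ('D_a ('D_b G) x)) = Omega (r2v a) (r2v b).
  have is_dG : is_derive x a G ('D_a G x).
    exact/derivableP/diff_derivable.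
  have is_ddG : is_derive x a ('D_b G) ('D_a ('D_b G) x).
    exact/derivableP/diff_derivable.
  have [_ <-] := is_derive_biscalar Omega is_dG is_ddG.
  have := is_derive_biscalar Omega (is_derive_id x a) (is_derive_cst b x a).
  rewrite !linear0 addr0 => -[_ <-].
  by congr ('D_a _ x); apply/funext => y; rewrite pullback_G.
have := diff_pullback u v; have := diff_pullback v u.
rewrite (derive_commute_rV smooth_G).
rewrite (symplectic_skew (r2v ('D_v G x))) (symplectic_skew (r2v v)).
lra.
Qed.

Lemma jacobian_isometry_unitmx x : jacobian G x \in unitmx.
Proof.
have [dG _] := smooth_G.
apply: isometry_unitmx => u v.
by rewrite -!deriveEjacobian // derive_isometry.
Qed.

(** [G x] and [D_x G x] have the same pairing with every [D_v G x], and these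
    vectors exhaust the space. *)
Lemma pullback_euler x : G x = 'D_x G x.
Proof.
have [dG _] := smooth_G; have [_ nondeg] := symplectic_Omega.
apply/eqP; rewrite -subr_eq0; apply/eqP; rewrite -[LHS]r2vK.
rewrite [r2v _]nondeg ?linear0 // => y.
pose v := v2r y *m invmx (jacobian G x).
have -> : y = r2v ('D_v G x).
  by rewrite deriveEjacobian // mulmxKV ?v2rK // jacobian_isometry_unitmx.
by rewrite linearB linearBl pullback_G derive_isometry subrr.
Qed.

End Symplectic.

Theorem theorem0p2 (R : realType) (V : vectType R) (Omega : {biscalar V})
    (symplectic_Omega : symplectic_form Omega)
    (g : V -> V) (smooth_g : smooth_map g)
    (pullback_g : pullback g (liouville_form Omega) = liouville_form Omega) :
  Sp Omega g.
Proof.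
pose G := in_chart g; have CG : class_C 2 G := smooth_g 2%N.
have [dG /all_and2[ddG _]] := CG.
have gE z : r2v (G (v2r z)) = g z by rewrite /G /in_chart /= !v2rK.
have pullback_G x v :
    Omega (r2v (G x)) (r2v ('D_v G x)) = Omega (r2v x) (r2v v).
  have := congr1 (fun alpha => alpha (r2v x) (r2v v)) pullback_g.
  rewrite /pullback /liouville_form /tangent_map -gE !r2vK -/G -deriveE //.
  by apply: mulfI; rewrite invr_neq0 // pnatr_eq0.
pose A := jacobian G 0.
have GE x : G x = x *m A.
  rewrite -deriveEjacobian //; apply: euler_linear => //.
  exact: (pullback_euler symplectic_Omega).
have unitA : A \in unitmx by exact: (jacobian_isometry_unitmx symplectic_Omega).
have {}gE z : g z = r2v (v2r z *m A) by rewrite -GE gE.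
split.
- by move=> a x y; rewrite !gE linearP mulmxDl -scalemxAl linearP.
- exists (fun z => r2v (v2r z *m invmx A)) => z.
    by rewrite gE r2vK mulmxK // v2rK.
  by rewrite gE r2vK mulmxKV // v2rK.
- move=> x y; rewrite !gE /A -!deriveEjacobian //.
  by rewrite (derive_isometry symplectic_Omega) // !v2rK.
Qed.
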